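(* Let $E$ and $\mathcal H$ be Hilbert spaces, let $0<A\le B<\infty$, and let $S:E\to\mathcal H$ be a bounded linear operator with $$A\|c\|^2\le\|Sc\|^2\le B\|c\|^2\qquad\text{for all }c\in E .$$ If $\widetilde S:E\to\mathcal H$ is a bounded linear operator with $\|\widetilde S-S\|\le\varepsilon<\sqrt A$, then for all $c\in E$ $$(\sqrt A-\varepsilon)^2\|c\|^2\le\|\widetilde Sc\|^2\le(\sqrt B+\varepsilon)^2\|c\|^2 .$$
   Context: Here $E$ plays the role of a fixed reduced (quotient) coefficient space, i.e. a coefficient space in which coefficient vectors representing the same function have been identified; the displayed two-sided inequality for $S$ is what is meant by ''quotient-Riesz bounds $A,B$''. *)

(* Defs.v *)
From HB Require Import structures.
From mathcomp Require Import all_boot all_order all_algebra.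
From mathcomp Require Import sesquilinear complex.
From mathcomp Require Import all_classical all_reals all_analysis.

Set Implicit Arguments.
Unset Strict Implicit.
Unset Printing Implicit Defensive.

Import Order.TTheory GRing.Theory Num.Theory.
Import numFieldNormedType.Exports.

Local Open Scope classical_set_scope.
Local Open Scope ring_scope.

(* Hilbert spaces may be real or complex; both cases are treated at once, by
   letting the scalar field depend on a tag. *)
Variant scalar_kind := RealScalars | ComplexScalars.

Definition scalar_field (R : realType) (k : scalar_kind) : numFieldType :=
  match k with
  | RealScalars => R : numFieldType
  | ComplexScalars => R[i] : numFieldType
  end.

Definition scalar_conj (R : realType) (k : scalar_kind) :
    scalar_field R k -> scalar_field R k :=
  match k return scalar_field R k -> scalar_field R k with
  | RealScalars => id
  | ComplexScalars => fun z : R[i] => z^*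
  end.

(* With this instance the library's theory of forms semilinear in the second
   argument applies to {dot E for @scalar_conj R k}. *)
Fact scalar_conj_is_zmod_morphism (R : realType) (k : scalar_kind) :
  zmod_morphism (@scalar_conj R k).
Proof. by case: k => //= x y; rewrite rmorphB. Qed.

Fact scalar_conj_is_monoid_morphism (R : realType) (k : scalar_kind) :
  monoid_morphism (@scalar_conj R k).
Proof. by case: k; split=> //= [|x y]; rewrite ?rmorph1 ?rmorphM. Qed.

HB.instance Definition _ (R : realType) (k : scalar_kind) :=
  GRing.isZmodMorphism.Build
    (scalar_field R k) (scalar_field R k) (@scalar_conj R k)
    (@scalar_conj_is_zmod_morphism R k).
HB.instance Definition _ (R : realType) (k : scalar_kind) :=
  GRing.isMonoidMorphism.Build
    (scalar_field R k) (scalar_field R k) (@scalar_conj R k)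
    (@scalar_conj_is_monoid_morphism R k).

Definition scalar_Re (R : realType) (k : scalar_kind) : scalar_field R k -> R :=
  match k return scalar_field R k -> R with
  | RealScalars => id
  | ComplexScalars => fun z : R[i] => complex.Re z
  end.

(* A complete normed space whose norm comes from an inner product that is
   linear in the first argument and conjugate-symmetric. *)
HB.mixin Record isHilbert (R : realType) (k : scalar_kind) E
    of CompleteNormedModule (scalar_field R k) E := {
  inner : {dot E for @scalar_conj R k} ;
  normr_inner : forall x : E, `|x| ^+ 2 = inner x x
}.

#[short(type="hilbertType")]
HB.structure Definition Hilbert (R : realType) (k : scalar_kind) :=
  {E of isHilbert R k E & CompleteNormedModule (scalar_field R k) E}.

(* The library norm `|x| lies in the scalar field, where it is a nonnegative
   real; hnorm x is the same number in R. *)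
Definition hnorm (R : realType) (k : scalar_kind)
    (E : normedModType (scalar_field R k)) (x : E) : R :=
  scalar_Re `|x|.

(* For an unbounded T this is a junk value (sup of an unbounded set). *)
Definition opnorm (R : realType) (k : scalar_kind)
    (E H : normedModType (scalar_field R k)) (T : E -> H) : R :=
  sup [set hnorm (T c) | c in [set c : E | hnorm c <= 1]].

(* Main.v *)
Require Import Defs.
From mathcomp Require Import all_boot all_order all_algebra.
From mathcomp Require Import complex lra.
From mathcomp Require Import all_classical all_reals all_analysis.
Set Implicit Arguments.
Unset Strict Implicit.
Unset Printing Implicit Defensive.

Import Order.TTheory GRing.Theory Num.Theory.
Import numFieldNormedType.Exports.
Local Open Scope classical_set_scope.
Local Open Scope ring_scope.

(** Taking square roots in the hypothesis on [S] gives [Num.sqrt A * hnorm c <= hnorm (S c) <=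
    Num.sqrt B * hnorm c]. By the triangle inequality ([ler_hnormD]), [hnorm (St c)] differs from
    [hnorm (S c)] by at most [hnorm (St c - S c)], which is at most [eps * hnorm c] by [ler_opnorm].
    Adding these estimates and squaring nonnegative quantities gives both bounds. *)

Lemma ler_scalar_Re (R : realType) (k : scalar_kind) (x y : scalar_field R k) :
  x <= y -> scalar_Re x <= scalar_Re y.
Proof. by case: k x y => //= x y; rewrite lecE => /andP[]. Qed.

Lemma scalar_ReD (R : realType) (k : scalar_kind) (x y : scalar_field R k) :
  scalar_Re (x + y) = scalar_Re x + scalar_Re y.
Proof. by case: k x y => //= -[? ?] [? ?]. Qed.

(** A nonnegative complex scalar has zero imaginary part, so the cross term of the product
    vanishes. *)
Lemma scalar_ReM_ge0 (R : realType) (k : scalar_kind) (x y : scalar_field R k) :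
  0 <= x -> scalar_Re (x * y) = scalar_Re x * scalar_Re y.
Proof.
case: k x y => //= -[a b] [c d]; rewrite lecE /= => /andP[/eqP -> _].
by rewrite mul0r subr0.
Qed.

Lemma scalar_Re0 (R : realType) (k : scalar_kind) :
  scalar_Re (0 : scalar_field R k) = 0.
Proof. by case: k. Qed.

Lemma scalar_Re1 (R : realType) (k : scalar_kind) :
  scalar_Re (1 : scalar_field R k) = 1.
Proof. by case: k. Qed.

Section Hnorm.
Variables (R : realType) (k : scalar_kind).
Implicit Types E H : normedModType (scalar_field R k).

Lemma hnorm_ge0 E (x : E) : 0 <= hnorm x.
Proof. by rewrite -(scalar_Re0 R k); apply: ler_scalar_Re. Qed.

Lemma hnorm0 E : hnorm (0 : E) = 0.
Proof. by rewrite /hnorm normr0 scalar_Re0. Qed.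

Lemma ler_hnormD E (x y : E) : hnorm (x + y) <= hnorm x + hnorm y.
Proof. by rewrite /hnorm -scalar_ReD; apply: ler_scalar_Re; exact: ler_normD. Qed.

Lemma hnorm_distC E (x y : E) : hnorm (x - y) = hnorm (y - x).
Proof. by rewrite /hnorm distrC. Qed.

Lemma hnormZ E (a : scalar_field R k) (x : E) :
  hnorm (a *: x) = scalar_Re `|a| * hnorm x.
Proof. by rewrite /hnorm normrZ scalar_ReM_ge0. Qed.

Lemma bounded_hnorm E H (T : {linear E -> H}) : bounded_near T (nbhs (0 : E)) ->
  exists M : R, forall x, hnorm (T x) <= M * hnorm x.
Proof.
move=> /linear_boundedP /pinfty_ex_gt0 [r r0 Tr]; exists (scalar_Re r) => x.
by rewrite /hnorm -scalar_ReM_ge0 ?(ltW r0)//; exact/ler_scalar_Re/Tr.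
Qed.

(** This makes the supremum in [opnorm] a genuine one rather than a default value. *)
Lemma opnorm_has_ubound E H (T : E -> H) (M : R) :
  (forall x, hnorm (T x) <= M * hnorm x) ->
  has_ubound [set hnorm (T c) | c in [set c : E | hnorm c <= 1]].
Proof.
(* The sign of [M] is unknown, and [hnorm c <= 1] bounds [M * hnorm c] by [M] only when [M] is
   nonnegative. *)
move=> TM; exists `|M| => _ [c /= c1 <-].
apply: (le_trans (TM c)); apply: (le_trans (ler_norm _)).
by rewrite normrM ler_piMr// ger0_norm ?hnorm_ge0.
Qed.

Lemma opnorm_ge0 E H (T : E -> H) (M : R) :
  (forall x, hnorm (T x) <= M * hnorm x) -> 0 <= opnorm T.
Proof.
move=> TM; apply: (le_trans (hnorm_ge0 (T 0))).
apply: (ub_le_sup (opnorm_has_ubound TM)).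
by exists 0; rewrite //= hnorm0.
Qed.

(** By homogeneity it suffices to normalise a nonzero [x] to a unit vector, whose image is one of
    the values under the supremum. The constant [M] only certifies that the supremum is finite. *)
Lemma ler_opnorm E H (T : {linear E -> H}) (M : R) :
  (forall x, hnorm (T x) <= M * hnorm x) ->
  forall x, hnorm (T x) <= opnorm T * hnorm x.
Proof.
move=> TM x; have [->|x0] := eqVneq x 0; first by rewrite linear0 !hnorm0 mulr0.
have nx0 : `|x| != 0 by rewrite normr_eq0.
have xE : x = `|x| *: (`|x|^-1 *: x) by rewrite scalerA divff// scale1r.
have unit_u : hnorm (`|x|^-1 *: x) = 1.
  by rewrite /hnorm normrZ normfV normr_id mulVf// scalar_Re1.
rewrite [in T x]xE linearZ hnormZ normr_id mulrC ler_wpM2r ?hnorm_ge0//.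
apply: (ub_le_sup (opnorm_has_ubound TM)).
by exists (`|x|^-1 *: x); rewrite //= unit_u.
Qed.

End Hnorm.

(* bounded_near _ (nbhs 0) is the library's boundedness of a linear map
   (see linear_boundedP). *)
Theorem corollary2p4 (R : realType) (k : scalar_kind) (E H : hilbertType R k)
    (A B eps : R) (S St : {linear E -> H}) :
  0 < A -> A <= B ->
  bounded_near S (nbhs (0 : E)) ->
  (forall c : E, A * hnorm c ^+ 2 <= hnorm (S c) ^+ 2 <= B * hnorm c ^+ 2) ->
  bounded_near St (nbhs (0 : E)) ->
  opnorm (fun c : E => St c - S c) <= eps ->
  eps < Num.sqrt A ->
  forall c : E,
    (Num.sqrt A - eps) ^+ 2 * hnorm c ^+ 2 <= hnorm (St c) ^+ 2
      <= (Num.sqrt B + eps) ^+ 2 * hnorm c ^+ 2.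
Proof.
move=> A0 AB /bounded_hnorm[M SM] SAB /bounded_hnorm[N StN] Deps epsA c.
(* A crude bound on the difference, needed so that its [opnorm] is meaningful. *)
have DM x : hnorm ((St \- S) x) <= (N + M) * hnorm x.
  have := ler_hnormD (St x) (- S x).
  have -> : hnorm (- S x) = hnorm (S x) by rewrite /hnorm normrN.
  by have := SM x; have := StN x; rewrite /= mulrDl; lra.
(* Nonnegativity of [eps] is derived here; it makes [Num.sqrt B + eps] nonnegative when squares are
   compared at the end. *)
have eps0 : 0 <= eps := le_trans (opnorm_ge0 DM) Deps.
have Dc : hnorm (St c - S c) <= eps * hnorm c.
  apply: (le_trans (ler_opnorm DM c)).
  by rewrite ler_wpM2r ?hnorm_ge0.
have c0 := hnorm_ge0 c.
have [lo up] : Num.sqrt A * hnorm c <= hnorm (S c) /\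
               hnorm (S c) <= Num.sqrt B * hnorm c.
  have B0 := le_trans (ltW A0) AB.
  have /andP[lo up] := SAB c; split.
    rewrite -ler_sqr ?nnegrE ?mulr_ge0 ?sqrtr_ge0 ?hnorm_ge0//.
    by rewrite exprMn sqr_sqrtr// ltW.
  rewrite -ler_sqr ?nnegrE ?mulr_ge0 ?sqrtr_ge0 ?hnorm_ge0//.
  by rewrite exprMn sqr_sqrtr.
have up' : hnorm (St c) <= hnorm (St c - S c) + hnorm (S c).
  by rewrite -[in leLHS](subrK (S c) (St c)) ler_hnormD.
have lo' : hnorm (S c) <= hnorm (St c - S c) + hnorm (St c).
  by rewrite hnorm_distC -[in leLHS](subrK (St c) (S c)) ler_hnormD.
(* Removing the squares in the lower bound uses [eps < Num.sqrt A]; what remains is linear in the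
   norms and products. *)
rewrite -!exprMn !ler_sqr ?nnegrE ?mulr_ge0 ?hnorm_ge0 ?subr_ge0 ?(ltW epsA)//;
  last by rewrite addr_ge0 ?sqrtr_ge0.
by rewrite mulrBl mulrDl; apply/andP; split; lra.
Qed.
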